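(* Let $\mathcal G=(\mathcal V,\mathcal E)$ be a bipartite graph, let $Gr\subset Aut(\mathcal G)$ be a subgroup, and let $X$ be an n.n.constraint space on $\mathcal G$ which is $Gr$-Hammersley-Clifford. Then every strong config-fold of $X$ is $Gr$-Hammersley-Clifford, and every $Gr$-invariant strong config-unfold of $X$ is $Gr$-Hammersley-Clifford.
   Context: Graphs: a graph $\mathcal G=(\mathcal V,\mathcal E)$ is a countable, locally finite, undirected graph without self-loops or multiple edges; $\sim$ denotes adjacency, $d_{\mathcal G}$ graph distance. For $F\subset\mathcal V$, $\partial F=\{u\in\mathcal V\setminus F: u\sim v\text{ for some }v\in F\}$, and $D_n(v)=\{w: d_{\mathcal G}(v,w)\le n\}$. A clique is a finite set of pairwise adjacent vertices (single vertices included). $Aut(\mathcal G)$ is the group of adjacency-preserving bijections of $\mathcal V$ (in both directions). Configurations: $\mathcal A$ is a finite alphabet, $\mathcal A^{\mathcal V}$ has the product topology, patterns are elements of $\mathcal A^F$, $F\subset \mathcal V$. For closed $X\subset\mathcal A^{\mathcal V}$, $\mathcal L_F(X)=\{x|_F:x\in X\}$ and $\mathcal L(X)=\bigcup_{F\text{ finite}}\mathcal L_F(X)$. $\langle a,c\rangle_{\{v,w\}}$ is the pattern with value $a$ at $v$ and $c$ at $w$; $b^F$ is the pattern on $F$ constantly $b$. An n.n.constraint space is a set of the form $\{x\in\mathcal A^{\mathcal V}:\text{ no pattern from }\mathcal F\text{ appears in }x\}$ where $\mathcal F$ is a set of patterns on cliques. Group action: for $g\in Aut(\mathcal G)$, $(gx)_v=x_{g^{-1}v}$,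 and for $\alpha\in\mathcal A^F$, $g\alpha\in\mathcal A^{gF}$ is $(g\alpha)_{gv}=\alpha_v$. $X$ is $Gr$-invariant if $gX=X$ for all $g\in Gr$. On interactions $gV(\alpha)=V(g^{-1}\alpha)$; $V$ is $Gr$-invariant if $gV=V$ for all $g\in Gr$. Cocycles: $\Delta_X=\{(x,y)\in X\times X: x,y\text{ differ at finitely many sites}\}$. A $\Delta_X$-cocycle is $M:\Delta_X\to\mathbb R$ with $M(x,z)=M(x,y)+M(y,z)$ for $(x,y),(y,z)\in\Delta_X$. It is a Markov cocycle if $M(x,y)$ depends only on $x|_{F\cup\partial F}$ and $y|_{F\cup\partial F}$, where $F$ is the set of sites where $x$ and $y$ differ. It is $Gr$-invariant if $M(gx,gy)=M(x,y)$ for all $g\in Gr$. A nearest neighbour interaction on $X$ is $V:\mathcal L(X)\to\mathbb R$ vanishing on patterns on finite sets that are not cliques. The Gibbs cocycle with interaction $V$ is $M(x,y)=\sum_{A\subset\mathcal V\text{ finite}}\big(V(y|_A)-V(x|_A)\big)$. For $Gr$-invariant $X$, $\mathbf M^{Gr}_X$ is the space of $Gr$-invariant Markov cocycles on $X$, and $\mathbf G^{Gr}_X$ is the space of Gibbs cocycles on $X$ with $Gr$-invariant nearest neighbour interactions. A $Gr$-invariant $X$ is $Gr$-Hammersley-Clifford if $\mathbf M^{Gr}_X=\mathbf G^{Gr}_X$ (so being $Gr$-Hammersley-Clifford includes being $Gr$-invariant). Folding: let $\mathcal G$ be bipartite, $X\subset\mathcal A^{\mathcal V}$ an n.n.constraint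 space, and $a,b\in\mathcal A$ distinct. $a$ can be strongly config-folded into $b$ if for all edges $(v_1,v_2),(v_2,v_3)\in\mathcal E$ and all $c\in\mathcal A$, $\langle a,c\rangle_{\{v_1,v_2\}}\in\mathcal L_{\{v_1,v_2\}}(X)$ implies $\langle b,c\rangle_{\{v_1,v_2\}}\in\mathcal L_{\{v_1,v_2\}}(X)$, $\langle c,b\rangle_{\{v_2,v_3\}}\in\mathcal L_{\{v_2,v_3\}}(X)$ and $b^{\partial D_1(v_1)}\in\mathcal L_{\partial D_1(v_1)}(X)$. In that case $X_a:=X\cap(\mathcal A\setminus\{a\})^{\mathcal V}$ is called a strong config-fold of $X$, and $X$ is called a strong config-unfold of $X_a$.
   Formalization: The unfold part additionally assumes that X is nonempty whenever the strong config-unfold is nonempty; without this the claim fails, since at isolated vertices folding imposes nothing and a non-Hammersley-Clifford space can be an unfold of the empty space. *)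

(* Defs.v *)
From HB Require Import structures.
From mathcomp Require Import all_boot all_order all_algebra.
From mathcomp Require Import all_classical reals.

Set Implicit Arguments.
Unset Strict Implicit.
Unset Printing Implicit Defensive.

Local Open Scope classical_set_scope.

Record graph (V : countType) := Graph {
  adj : rel V;
  adj_sym : symmetric adj;
  adj_irrefl : irreflexive adj;
  adj_locally_finite : forall v, finite_set [set w | adj v w] }.

Section Graph.
Context {V : countType} (G : graph V).

Definition bipartite :=
  exists side : V -> bool, forall v w, adj G v w -> side v != side w.

Definition boundary (F : set V) : set V :=
  [set u | ~ F u /\ exists2 v, F v & adj G u v].

(* [d(v, w) <= n] means that some walk of length at most [n] goes from [v] to
   [w]; this is also meaningful when the graph is not connected. *)
Definition ball (n : nat) (v : V) : set V :=
  [set w | exists p : seq V, [/\ path (adj G) v p, last v p = w & size p <= n]].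

Definition clique (F : set V) :=
  finite_set F /\ forall v w, F v -> F w -> v <> w -> adj G v w.

Record aut := Aut {
  aut_fun :> V -> V;
  aut_inv : V -> V;
  aut_funK : cancel aut_fun aut_inv;
  aut_invK : cancel aut_inv aut_fun;
  aut_adj : forall v w, adj G (aut_fun v) (aut_fun w) = adj G v w }.

Lemma aut_eq (g h : aut) : g =1 h -> g = h.
Proof.
case: g h => [f f' fK f'K fE] [k k' kK k'K kE] /= /funext fk.
rewrite {}fk in fK f'K fE *.
have fk' : f' = k' by apply/funext => v; rewrite -[in LHS](k'K v) fK.
rewrite {}fk' in fK f'K *.
by congr Aut; apply: Prop_irrelevance.
Qed.

Definition aut_one : aut :=
  @Aut id id (fun=> erefl) (fun=> erefl) (fun _ _ => erefl).

Lemma aut_mul_adj (g h : aut) v w : adj G (g (h v)) (g (h w)) = adj G v w.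
Proof. by rewrite !aut_adj. Qed.

Definition aut_mul (g h : aut) : aut :=
  Aut (can_comp (aut_funK g) (aut_funK h))
      (can_comp (aut_invK h) (aut_invK g)) (aut_mul_adj g h).

Lemma aut_opp_adj (g : aut) v w : adj G (aut_inv g v) (aut_inv g w) = adj G v w.
Proof. by rewrite -(aut_adj g) !aut_invK. Qed.

Definition aut_opp (g : aut) : aut :=
  Aut (aut_invK g) (aut_funK g) (aut_opp_adj g).

HB.instance Definition _ := gen_eqMixin aut.
HB.instance Definition _ := gen_choiceMixin aut.

Lemma aut_mulA : associative aut_mul.
Proof. by move=> g h k; apply: aut_eq. Qed.

Lemma aut_mul1 : left_id aut_one aut_mul.
Proof. by move=> g; apply: aut_eq. Qed.

Lemma aut_1mul : right_id aut_one aut_mul.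
Proof. by move=> g; apply: aut_eq. Qed.

Lemma aut_mulV : left_inverse aut_one aut_opp aut_mul.
Proof. by move=> g; apply: aut_eq => v; apply: aut_funK. Qed.

Lemma aut_Vmul : right_inverse aut_one aut_opp aut_mul.
Proof. by move=> g; apply: aut_eq => v; apply: aut_invK. Qed.

HB.instance Definition _ := isGroup.Build aut
  aut_mulA aut_mul1 aut_1mul aut_mulV aut_Vmul.

End Graph.

(* Letters are taken from an ambient type [S], and the finite alphabet is a
   finite set [L : set S]: the alphabets of a space, of its folds and of its
   unfolds are then subsets of one type. *)
Section Patterns.
Context {V : countType} (G : graph V) {S : choiceType}.

Local Notation config := (V -> S).

(* A pattern on [F] is a partial function with domain [F]. *)
Definition pattern := V -> option S.

Definition shape (p : pattern) : set V := [set v | p v != None].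

Definition restr (x : config) (F : set V) : pattern :=
  fun v => if `[< F v >] then Some (x v) else None.

Definition pair_pattern (a c : S) (v w : V) : pattern :=
  fun u => if u == v then Some a else if u == w then Some c else None.

Definition const_pattern (b : S) (F : set V) : pattern := restr (fun=> b) F.

Definition language_on (X : set config) (F : set V) : set pattern :=
  [set restr x F | x in X].

Definition language (X : set config) : set pattern :=
  \bigcup_(F in [set F : set V | finite_set F]) language_on X F.

Definition nn_constraint_space (L : set S) (X : set config) :=
  finite_set L /\
  exists Forb : set pattern,
    (forall p, Forb p -> clique G (shape p)) /\
    X = [set x | (forall v, L (x v)) /\
                 forall p, Forb p -> restr x (shape p) <> p].

Definition act_config (g : aut G) (x : config) : config :=
  fun v => x ((g^-1)%g v).

Definition act_pattern (g : aut G) (p : pattern) : pattern :=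
  fun v => p ((g^-1)%g v).

Definition invariant_space (Gr : {pred aut G}) (X : set config) :=
  forall g, g \in Gr -> act_config g @` X = X.

Definition differ (x y : config) : set V := [set v | x v <> y v].

Definition asymptotic (X : set config) (x y : config) :=
  [/\ X x, X y & finite_set (differ x y)].

Definition strongly_config_folds (X : set config) (a b : S) (L : set S) :=
  forall v1 v2 v3 c, adj G v1 v2 -> adj G v2 v3 -> L c ->
    language_on X [set v1; v2] (pair_pattern a c v1 v2) ->
    [/\ language_on X [set v1; v2] (pair_pattern b c v1 v2),
        language_on X [set v2; v3] (pair_pattern c b v2 v3) &
        language_on X (boundary G (ball G 1 v1))
          (const_pattern b (boundary G (ball G 1 v1)))].

(* [Y] is a strong config-fold of [X], a space with alphabet [L]. *)
Definition strong_config_fold (L : set S) (X Y : set config) :=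
  exists a b, [/\ L a, L b, a <> b, strongly_config_folds X a b L &
    Y = X `&` [set x | forall v, (L `\ a) (x v)]].

(* [Z] is a strong config-unfold of [X]; the alphabet of [Z] is arbitrary. *)
Definition strong_config_unfold (X Z : set config) :=
  exists L, nn_constraint_space L Z /\ strong_config_fold L Z X.

End Patterns.

(* Functions on [asymptotic X] and on [language X] are represented by total
   functions; every condition below only involves the values at asymptotic
   pairs of [X], respectively at patterns of [language X]. *)
Section Cocycles.
Context {R : realType} {V : countType} (G : graph V) {S : choiceType}.
Variables (Gr : {pred aut G}) (X : set (V -> S)).

Local Open Scope ring_scope.

Definition cocycle (M : (V -> S) -> (V -> S) -> R) :=
  forall x y z, asymptotic X x y -> asymptotic X y z ->
    M x z = M x y + M y z.

Definition markov_cocycle (M : (V -> S) -> (V -> S) -> R) :=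
  cocycle M /\
  forall x y x' y', asymptotic X x y -> asymptotic X x' y' ->
    let F := differ x y in let F' := differ x' y' in
    restr x (F `|` boundary G F) = restr x' (F' `|` boundary G F') ->
    restr y (F `|` boundary G F) = restr y' (F' `|` boundary G F') ->
    M x y = M x' y'.

Definition invariant_cocycle (M : (V -> S) -> (V -> S) -> R) :=
  forall g, g \in Gr -> forall x y, asymptotic X x y ->
    M (act_config g x) (act_config g y) = M x y.

Definition nn_interaction (U : @pattern V S -> R) :=
  forall p, language X p -> ~ clique G (shape p) -> U p = 0.

Definition invariant_interaction (U : @pattern V S -> R) :=
  forall g, g \in Gr -> forall p, language X p ->
    U (act_pattern (g^-1)%g p) = U p.

(* For a nearest neighbour interaction and an asymptotic pair, only the finitely
   many cliques that meet [differ x y] contribute a nonzero term. *)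
Definition gibbs_cocycle (U : @pattern V S -> R) (x y : V -> S) : R :=
  \sum_(A \in [set A : set V | finite_set A]) (U (restr y A) - U (restr x A)).

Definition markov_cocycles : set ((V -> S) -> (V -> S) -> R) :=
  [set M | markov_cocycle M /\ invariant_cocycle M].

Definition gibbs_cocycles : set ((V -> S) -> (V -> S) -> R) :=
  [set M | exists U, [/\ nn_interaction U, invariant_interaction U &
    forall x y, asymptotic X x y -> M x y = gibbs_cocycle U x y]].

End Cocycles.

Definition hammersley_clifford (R : realType) {V : countType} (G : graph V)
    {S : choiceType} (Gr : {pred aut G}) (X : set (V -> S)) :=
  invariant_space Gr X /\ @markov_cocycles R V G S Gr X = gibbs_cocycles Gr X.

(* Main.v *)
Require Import Defs.
From mathcomp Require Import all_boot all_order all_algebra.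
From mathcomp Require Import all_classical reals.
From mathcomp Require Import lra.

Local Open Scope classical_set_scope.

Set Implicit Arguments.
Unset Strict Implicit.

Import GRing.Theory.

(** Let [X] be the larger space, [Y] its fold (the configurations of [X] that
    avoid the letter [a]), and let folding replace every [a] by [b]. Folding maps
    [X] into [Y] because [b] may stand wherever [a] does, it acts site by site,
    and it commutes with the group. At an isolated vertex the folding condition
    says nothing, so there [a] is replaced by a letter chosen as a function of
    the set of admissible letters, which keeps folding equivariant.

    A Gibbs cocycle is always a Markov cocycle ([gibbs_sub_markov]), so in each
    direction only the other inclusion matters.

    From [X] to [Y] ([fold_hammersley_clifford]): a Markov cocycle on [Y],
    precomposed with folding, is a Markov cocycle on [X]; its interaction,
    restricted to the patterns of [Y], is what is needed.

    From [Y] to [X] ([unfold_hammersley_clifford]): a Markov cocycle on [X] is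
    Gibbs on [Y]; extending the interaction by zero and subtracting, one may
    assume that the cocycle [M] vanishes on [Y]. Such an [M] is determined by the
    cost [cost v x] of replacing an [a] at one site [v], since any asymptotic pair
    is brought into [Y] by finitely many such replacements near the sites of
    difference, followed by a folding elsewhere that the Markov property does not
    see. The cost depends on the letters at the neighbours of [v]. The heart of
    the proof is that it is a constant plus a sum of one contribution for each
    neighbour ([cost_sum]): strong folding allows the letter [b] at all vertices
    at distance two from [v] while [a] stands at [v], and in such surroundings the
    change of the letter at one neighbour [w] has a cost depending on that letter
    only, because all neighbours of [w] carry known letters ([cost_exchange]).
    Bipartiteness makes this possible, as neighbours of [v] do not see each
    other. The contributions define an edge potential. When both ends of an edge
    carry an [a], the two orders of removing them must give the same value, which
    is the cocycle equation around a square ([pair_cost_sym]). The resulting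
    interaction reproduces the cost of every replacement
    ([gibbs_fold_interaction]) and vanishes on [Y], so its Gibbs cocycle is [M]
    ([fold_gibbs]). *)

(** * Closed neighbourhoods and cliques *)

Section Neighbourhoods.
Context {V : countType} (G : graph V).

Definition nbr (v w : V) : bool := (v == w) || adj G v w.

Lemma nbr_refl v : nbr v v.
Proof. by rewrite /nbr eqxx. Qed.

Lemma nbr_sym v w : nbr v w = nbr w v.
Proof. by rewrite /nbr eq_sym adj_sym. Qed.

Lemma adj_nbr v w : adj G v w -> nbr v w.
Proof. by rewrite /nbr => ->; rewrite orbT. Qed.

Lemma adj_neq v w : adj G v w -> v <> w.
Proof. by move=> + vw; rewrite vw adj_irrefl. Qed.

Lemma nbr_aut (g : aut G) v w : nbr (g v) (g w) = nbr v w.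
Proof. by rewrite /nbr aut_adj (can_eq (aut_funK g)). Qed.

Lemma finite_nbr v : finite_set [set w | nbr v w].
Proof.
apply: (@sub_finite_set _ _ ([set v] `|` [set w | adj G v w])).
  by move=> w /orP[/eqP<-|vw]; [left|right].
by rewrite finite_setU; split; [exact: finite_set1|exact: adj_locally_finite].
Qed.

Definition closed_nbhd (F : set V) : set V := F `|` boundary G F.

Lemma closed_nbhdP F u : closed_nbhd F u <-> exists2 v, F v & nbr v u.
Proof.
split=> [[Fu|[_ [v Fv uv]]]|[v Fv /orP[/eqP<-|vu]]].
- by exists u => //; exact: nbr_refl.
- by exists v => //; rewrite nbr_sym adj_nbr.
- by left.
- have [Fu|nFu] := pselect (F u); first by left.
  by right; split=> //; exists v => //; rewrite adj_sym.
Qed.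

Lemma subset_closed_nbhd F F' : F `<=` F' -> closed_nbhd F `<=` closed_nbhd F'.
Proof.
by move=> FF' u /closed_nbhdP[v /FF' F'v vu]; apply/closed_nbhdP; exists v.
Qed.

Lemma finite_closed_nbhd F : finite_set F -> finite_set (closed_nbhd F).
Proof.
move=> Ffin; apply: (@sub_finite_set _ _ (\bigcup_(v in F) [set w | nbr v w])).
  by move=> u /closed_nbhdP[v Fv vu]; exists v.
by apply: bigcup_finite => // v _; exact: finite_nbr.
Qed.

Definition cliques_meeting (F : set V) : set (set V) :=
  [set A | clique G A /\ A `&` F !=set0].

Lemma cliques_meeting_sub F A : cliques_meeting F A -> A `<=` closed_nbhd F.
Proof.
move=> [[_ Acl] [v [Av Fv]]] w Aw; apply/closed_nbhdP; exists v => //.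
have [->|/eqP vw] := eqVneq v w; first exact: nbr_refl.
by apply: adj_nbr; apply: Acl.
Qed.

(** A clique that meets a finite set is a subset of the finite closed
    neighbourhood of that set, hence one of finitely many masks of an
    enumeration of it. *)
Lemma finite_cliques_meeting F : finite_set F -> finite_set (cliques_meeting F).
Proof.
move=> /finite_closed_nbhd/finite_seqP[s sE].
apply: (@sub_finite_set _ _
  ((fun m : (size s).-tuple bool => [set` mask m s]) @` setT)).
  move=> A /cliques_meeting_sub; rewrite sE => As.
  exists (map_tuple (fun v => `[< A v >]) (in_tuple s)) => //=.
  apply/seteqP; split=> v /=.
    by rewrite -filter_mask mem_filter => /andP[/asboolP].
  by move=> Av; rewrite -filter_mask mem_filter (As v Av) andbT; apply/asboolP.
by apply: finite_image; exact: finite_finset.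
Qed.

Definition dist2 (v : V) : set V := boundary G (ball G 1 v).

Lemma ball1P v u : ball G 1 v u <-> nbr v u.
Proof.
split=> [[[|w [|? ?]] []]//= + <- _|/orP[/eqP<-|vu]].
- by move=> _; exact: nbr_refl.
- by rewrite andbT => /adj_nbr.
- by exists [::].
- by exists [:: u]; split=> //=; rewrite vu.
Qed.

Lemma dist2P v u :
  dist2 v u <-> ~~ nbr v u /\ exists2 w, adj G v w & adj G w u.
Proof.
split=> [[nb [w /ball1P vw uw]]|[nvu [w vw wu]]].
  split; first by apply/negP => /ball1P.
  exists w; last by rewrite adj_sym.
  case/orP: vw => // /eqP vw; case: nb; apply/ball1P.
  by apply: adj_nbr; rewrite vw adj_sym.
split; first by move=> /ball1P; exact/negP.
by exists w; [apply/ball1P; exact: adj_nbr|rewrite adj_sym].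
Qed.

Hypothesis bip : bipartite G.

Lemma adj_triangle_free u v w : adj G u v -> adj G v w -> adj G u w = false.
Proof.
case: bip => s sP /sP uv /sP vw; apply/negP => /sP.
by case: (s u) (s v) (s w) uv vw => -[] [].
Qed.

(** With no triangle, a clique has at most two elements. Taking [v = w] for the
    singletons lets vertices and edges be treated together below. *)
Lemma bipartite_clique A : clique G A ->
  A = set0 \/ exists v w, nbr v w /\ A = [set v; w].
Proof.
move=> [_ Acl]; have [->|/set0P[v Av]] := eqVneq A set0; first by left.
right; have [[w [Aw vw]]|nw] := pselect (exists w, A w /\ v <> w).
  exists v, w; have avw := Acl _ _ Av Aw vw.
  split; first exact: adj_nbr.
  apply/seteqP; split=> [u Au|u [->|->]]//.
  apply: contrapT => /not_orP[uv uw].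
  have := adj_triangle_free avw (Acl _ _ Aw Au (nesym uw)).
  by rewrite (Acl _ _ Av Au (nesym uv)).
exists v, v; split; first exact: nbr_refl.
rewrite setUid; apply/seteqP; split=> [u Au|u ->//].
by apply: contrapT => uv; apply: nw; exists u; split=> // /esym.
Qed.

Lemma nbr_clique v w : nbr v w -> clique G [set v; w].
Proof.
move=> vw; split; first by rewrite finite_setU; split; exact: finite_set1.
case/orP: vw => [/eqP->|vw]; first by move=> u u' [->|->] [->|->].
by move=> u u' [->|->] [->|->]//; rewrite adj_sym.
Qed.

End Neighbourhoods.

(** * Patterns and configurations *)

Section Patterns.
Context {V : countType} {S : choiceType}.
Implicit Types (x y z : V -> S) (A B : set V).

Lemma shape_restr x A : Defs.shape (restr x A) = A.
Proof.
apply/seteqP; split=> v; rewrite /Defs.shape /restr /=; case: asboolP => //.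
Qed.

Lemma differ_agree x y x' y' A : differ x y `<=` A -> differ x' y' `<=` A ->
  {in A, x =1 x'} -> {in A, y =1 y'} -> differ x y = differ x' y'.
Proof.
move=> xyA xyA' xx' yy'; apply/seteqP; split=> v vd.
  have Av : v \in A by rewrite inE; exact: xyA.
  by move: vd; rewrite /differ /= xx'// yy'.
have Av : v \in A by rewrite inE; exact: xyA'.
by move: vd; rewrite /differ /= xx'// yy'.
Qed.

Lemma eq_restr x y A : {in A, x =1 y} -> restr x A = restr y A.
Proof.
move=> xy; apply/funext => v; rewrite /restr; case: asboolP => // Av.
by rewrite xy ?inE.
Qed.

Lemma restr_inj x y A B : restr x A = restr y B -> A = B /\ {in A, x =1 y}.
Proof.
move=> xy; have AB : A = B by rewrite -(shape_restr x A) xy shape_restr.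
split=> // v; rewrite inE => Av; have := congr1 (@^~ v) xy.
by rewrite /restr -AB asboolT// => -[].
Qed.

Lemma differ_trans y x z : differ x z `<=` differ x y `|` differ y z.
Proof.
move=> v xz; have [xy|] := pselect (x v = y v); last by left.
by right => yz; apply: xz; rewrite xy.
Qed.

Lemma asymptotic_trans X y x z :
  asymptotic X x y -> asymptotic X y z -> asymptotic X x z.
Proof.
move=> [Xx _ xy] [_ Xz yz]; split=> //.
by apply: sub_finite_set (@differ_trans y x z) _; rewrite finite_setU.
Qed.

Lemma asymptotic_refl X x : X x -> asymptotic X x x.
Proof.
move=> Xx; split=> //; rewrite (_ : differ x x = set0)//.
by apply/seteqP; split=> v //=; exact.
Qed.

Lemma language_restr X x A : X x -> finite_set A -> language X (restr x A).
Proof. by move=> Xx Afin; exists A => //; exists x. Qed.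

Lemma sub_language (X Y : set (V -> S)) :
  Y `<=` X -> language Y `<=` language X.
Proof. by move=> YX _ [A Afin [x /YX Xx <-]]; exact: language_restr. Qed.

End Patterns.

(** * The action of automorphisms *)

Section Action.
Context {V : countType} {G : graph V} {S : choiceType}.
Implicit Types (x y z : V -> S) (A : set V) (g : aut G).

Lemma autK g : cancel g (g^-1)%g.
Proof. exact: (aut_funK g). Qed.

Lemma autVK g : cancel (g^-1)%g g.
Proof. exact: (aut_invK g). Qed.

Lemma image_autK g A : (g^-1)%g @` (g @` A) = A.
Proof.
rewrite -[RHS]image_id image_comp; apply: eq_imagel => v _; exact: autK.
Qed.

Lemma act_configE g x v : act_config g x (g v) = x v.
Proof. by rewrite /act_config autK. Qed.

Lemma act_configK g : cancel (@act_config _ _ S g) (act_config (g^-1)%g).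
Proof.
move=> x; apply/funext => v; rewrite /act_config.
by congr x; rewrite (autVK (g^-1)%g).
Qed.

Lemma act_restr g x A :
  act_pattern g (restr x A) = restr (act_config g x) (g @` A).
Proof.
apply/funext => v; rewrite /act_pattern /restr /act_config.
congr (if _ then _ else _); apply/asboolP/asboolP => [Av|[u Au <-]].
  by exists ((g^-1)%g v) => //; exact: autVK.
by rewrite autK.
Qed.

Lemma act_patternK g : cancel (@act_pattern _ _ S g) (act_pattern (g^-1)%g).
Proof.
move=> p; apply/funext => v; rewrite /act_pattern.
by congr p; rewrite (autVK (g^-1)%g).
Qed.

Lemma differ_act g x y :
  differ (act_config g x) (act_config g y) = g @` differ x y.
Proof.
apply/seteqP; split=> [v xy|_ [v xy <-]]; last first.
  by rewrite /differ /= !act_configE.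
by exists ((g^-1)%g v) => //; exact: autVK.
Qed.

Variables (Gr : {pred aut G}) (X : set (V -> S)).
Hypotheses (GrG : group_closed Gr) (Xinv : invariant_space Gr X).

Lemma invariant_act g x : g \in Gr -> X x -> X (act_config g x).
Proof. by move=> gGr Xx; rewrite -(Xinv gGr); exists x. Qed.

Lemma asymptotic_act g x y : g \in Gr -> asymptotic X x y ->
  asymptotic X (act_config g x) (act_config g y).
Proof.
move=> gGr [Xx Xy xy]; split; try exact: invariant_act.
by rewrite differ_act; exact: finite_image.
Qed.

Lemma language_act g p :
  g \in Gr -> language X p -> language X (act_pattern g p).
Proof.
move=> gGr [A Afin [x Xx <-]]; rewrite act_restr.
by apply: language_restr; [exact: invariant_act|exact: finite_image].
Qed.

Lemma invariant_spaceI (P : set (V -> S)) :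
  (forall g x, P x -> P (act_config g x)) -> invariant_space Gr (X `&` P).
Proof.
move=> Pact g gGr; apply/seteqP; split=> [_ [x [Xx Px] <-]|x [Xx Px]].
  by split; [exact: invariant_act|exact: Pact].
exists (act_config (g^-1)%g x); last by rewrite -[g in LHS]invgK act_configK.
split; last exact: Pact.
by apply: invariant_act Xx; exact: group_closedV.
Qed.

End Action.

(** * Markov and Gibbs cocycles *)

Section Gibbs.
Context {R : realType} {V : countType} {G : graph V} {S : choiceType}.
Implicit Types (x y z : V -> S) (F A : set V) (U : @pattern V S -> R).

Local Open Scope ring_scope.

Variables (Gr : {pred aut G}) (X : set (V -> S)).

(** The usable form of the Markov property: the pairs need not be compared on
    the exact sets of difference, any common superset does. *)
Lemma markov_local M F x y x' y' : @markov_cocycle R _ G _ X M ->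
  asymptotic X x y -> asymptotic X x' y' ->
  differ x y `<=` F -> differ x' y' `<=` F ->
  {in closed_nbhd G F, x =1 x'} -> {in closed_nbhd G F, y =1 y'} ->
  M x y = M x' y'.
Proof.
move=> [_ Mloc] xy xy' dF dF' xx' yy'.
have dd : differ x y = differ x' y'.
  by apply: (differ_agree (A := closed_nbhd G F)) => // v; left;
    [exact: dF|exact: dF'].
have sub : differ x y `|` boundary G (differ x y) `<=` closed_nbhd G F.
  exact: subset_closed_nbhd.
apply: Mloc => //; rewrite -dd; apply: eq_restr => v; rewrite inE => /sub vF.
  by rewrite xx' ?inE.
by rewrite yy' ?inE.
Qed.

Lemma cocycle_refl M x : @cocycle R _ _ X M -> X x -> M x x = 0.
Proof.
move=> Mc /asymptotic_refl xx; have := Mc _ _ _ xx xx.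
by move/eqP; rewrite -subr_eq0 opprD addNKr oppr_eq0 => /eqP.
Qed.

(** Turns the sum over all finite sets into a finite one, whose index set
    can be chosen large enough to serve several pairs at once. *)
Lemma gibbs_cliques_meeting U F x y : nn_interaction G X U -> X x -> X y ->
  differ x y `<=` F ->
  gibbs_cocycle U x y =
  \sum_(A \in cliques_meeting G F) (U (restr y A) - U (restr x A)).
Proof.
move=> nnU Xx Xy dF; apply/esym/fsbig_widen => [A [[]]//|A [Afin nA] /=].
have [Acl|nAcl] := pselect (clique G A); last first.
  by rewrite !nnU ?subr0 ?shape_restr//; exact: language_restr.
rewrite (@eq_restr _ _ y x) ?subrr// => v; rewrite inE => Av.
apply: contrapT => /nesym xyv; apply: nA; split=> //; exists v.
by split=> //; exact: dF.
Qed.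

Lemma gibbs_cocycleP U : nn_interaction G X U -> cocycle X (gibbs_cocycle U).
Proof.
move=> nnU x y z [Xx Xy xy] [_ Xz yz].
pose F := differ x y `|` differ y z.
rewrite !(gibbs_cliques_meeting (F := F))//;
  [|exact: subsetUr|exact: subsetUl|exact: differ_trans].
rewrite -fsbig_split/=; last first.
  by apply: finite_cliques_meeting; rewrite finite_setU.
by apply: eq_fsbigr => A _; rewrite addrC addrA subrK.
Qed.

Lemma gibbs_markov U :
  nn_interaction G X U -> markov_cocycle G X (gibbs_cocycle U).
Proof.
move=> nnU; split; first exact: gibbs_cocycleP.
move=> x y x' y' [Xx Xy _] [Xx' Xy' _] F F' /restr_inj[FF' xx'].
move=> /restr_inj[_ yy'].
have dd : F = F'.
  apply: differ_agree xx' yy'; first exact: subsetUl.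
  by rewrite FF'; exact: subsetUl.
rewrite (gibbs_cliques_meeting (F := F))//.
rewrite (gibbs_cliques_meeting (F := F) nnU Xx')//; last by rewrite dd.
apply: eq_fsbigr => A; rewrite inE => /cliques_meeting_sub AF.
congr (U _ - U _); apply: eq_restr => v; rewrite inE => /AF vF.
  by rewrite yy' ?inE.
by rewrite xx' ?inE.
Qed.

Lemma gibbs_invariant U : group_closed Gr -> 
  invariant_interaction Gr X U -> invariant_cocycle Gr X (gibbs_cocycle U).
Proof.
move=> GrG Uinv g gGr x y [Xx Xy xy].
rewrite /gibbs_cocycle (reindex_fsbig (image^~ g) [set A | finite_set A]).
  apply: eq_fsbigr => A; rewrite inE => Afin.
  have Uact z : X z -> U (restr (act_config g z) (g @` A)) = U (restr z A).
    move=> Xz; rewrite -act_restr -[in LHS](invgK g).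
    by apply: Uinv; [exact: group_closedV|exact: language_restr].
  by rewrite !Uact.
split=> [A Afin|A B _ _ /(congr1 (image^~ (g^-1)%g))|A Afin].
- exact: finite_image.
- by rewrite /= !image_autK.
- exists ((g^-1)%g @` A); first exact: finite_image.
  by rewrite -[g in LHS]invgK image_autK.
Qed.

(** The easy half of the Hammersley-Clifford property, valid for every invariant
    space: the cliques that meet the set of difference lie in its closed
    neighbourhood. *)
Lemma gibbs_sub_markov : group_closed Gr -> invariant_space Gr X ->
  gibbs_cocycles Gr X `<=` @markov_cocycles R V G S Gr X.
Proof.
move=> GrG Xinv M [U [nnU Uinv MU]].
have [Uc Uloc] := gibbs_markov nnU; split; [split|].
- move=> x y z xy yz; rewrite !MU ?(Uc x y z)//.
  exact: asymptotic_trans xy yz.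
- by move=> x y x' y' xy xy' F F' *; rewrite !MU//; exact: Uloc.
- move=> g gGr x y xy.
  have gxy := asymptotic_act Xinv gGr xy.
  by rewrite !MU// (gibbs_invariant GrG Uinv).
Qed.

Lemma gibbs_cocycleD U U' x y : nn_interaction G X U -> nn_interaction G X U' ->
  asymptotic X x y ->
  gibbs_cocycle (fun p => U p + U' p) x y =
  gibbs_cocycle U x y + gibbs_cocycle U' x y.
Proof.
move=> nnU nnU' [Xx Xy xy].
have nnUU' : nn_interaction G X (fun p => U p + U' p).
  by move=> p Xp pcl; rewrite nnU// nnU'// addr0.
rewrite !(gibbs_cliques_meeting (F := differ x y))// -fsbig_split/=.
  by apply: eq_fsbigr => A _; rewrite opprD addrACA.
exact: finite_cliques_meeting.
Qed.

Lemma markov_cocyclesB M M' : @markov_cocycles R V G S Gr X M ->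
  markov_cocycles Gr X M' -> markov_cocycles Gr X (fun x y => M x y - M' x y).
Proof.
move=> [[Mc Mloc] Minv] [[Mc' Mloc'] Minv']; split; [split|].
- by move=> x y z xy yz; rewrite (Mc x y z)// (Mc' x y z)// opprD addrACA.
- move=> x y x' y' xy xy' F F' Fx Fy.
  by rewrite (Mloc x y x' y')// (Mloc' x y x' y').
- by move=> g gGr x y xy; rewrite Minv// Minv'.
Qed.

Lemma hammersley_cliffordP : group_closed Gr -> invariant_space Gr X ->
    (forall M, @markov_cocycles R V G S Gr X M -> gibbs_cocycles Gr X M) ->
  hammersley_clifford R Gr X.
Proof.
move=> GrG Xinv MG; split=> //; apply/seteqP; split=> [M /MG//|].
exact: gibbs_sub_markov.
Qed.

Lemma hammersley_clifford_empty : group_closed Gr -> invariant_space Gr X ->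
  ~ (X !=set0) -> hammersley_clifford R Gr X.
Proof.
move=> GrG Xinv X_nonempty; apply: hammersley_cliffordP => // M _.
by exists (fun=> 0); split=> // x y [Xx]; case: X_nonempty; exists x.
Qed.

End Gibbs.

(** * Interactions from edge potentials *)

Section Potential.
Context {R : realType} {V : countType} {G : graph V} {S : choiceType}.
Variables (Gr : {pred aut G}) (X : set (V -> S)).
Hypotheses (GrG : group_closed Gr) (Xinv : invariant_space Gr X).

Local Open Scope ring_scope.

Variable E : V -> V -> S -> S -> R.

(** The interaction that gives the vertex pattern [c] at [v] the value
    [E v v c c] and the edge pattern [c] at [v], [d] at [w] the value
    [E v w c d]. An unordered edge has two descriptions, so the value is selected
    by a relation, and it is the intended one when [E] is symmetric. The relation
    transports under the group as a whole, so invariance needs no symmetry. *)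
Definition potential (p : @pattern V S) : R :=
  xget 0 [set t | exists v w x, [/\ nbr G v w, X x, p = restr x [set v; w] &
                                    t = E v w (x v) (x w)]].

Lemma potential_restr v w x :
    (forall v w x, nbr G v w -> X x -> E v w (x v) (x w) = E w v (x w) (x v)) ->
  nbr G v w -> X x -> potential (restr x [set v; w]) = E v w (x v) (x w).
Proof.
move=> Esym vw Xx; apply: xget_unique; first by exists v, w, x.
move=> _ [v' [w' [x' [vw' Xx' /restr_inj[vwE xx'] ->]]]].
have xv : x v = x' v by apply: xx'; rewrite inE; left.
have xw : x w = x' w by apply: xx'; rewrite inE; right.
have : [set v; w] v' /\ [set v; w] w' by rewrite vwE; split; [left|right].
have : [set v'; w'] v /\ [set v'; w'] w by rewrite -vwE; split; [left|right].
rewrite xv xw /= => -[[vv'|vv'] [ww'|ww']] [[v'v|v'v] [w'w|w'w]]; subst => //.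
by rewrite Esym.
Qed.

Lemma potential_nn : bipartite G -> nn_interaction G X potential.
Proof.
move=> bip p _ pcl; apply: xgetPN => t [v [w [x [vw _ pE _]]]].
by apply: pcl; rewrite pE shape_restr; exact: nbr_clique.
Qed.

Lemma potential_invariant :
    (forall g v w x, g \in Gr -> nbr G v w -> X x ->
       E (g v) (g w) (x v) (x w) = E v w (x v) (x w)) ->
  invariant_interaction Gr X potential.
Proof.
move=> Einv; have sub g p t : g \in Gr ->
  (exists v w x, [/\ nbr G v w, X x, p = restr x [set v; w] &
                     t = E v w (x v) (x w)]) ->
  exists v w x, [/\ nbr G v w, X x, act_pattern g p = restr x [set v; w] &
                     t = E v w (x v) (x w)].
  move=> gGr [v [w [x [vw Xx -> ->]]]].
  exists (g v), (g w), (act_config g x); split.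
  - by rewrite nbr_aut.
  - exact: (invariant_act Xinv).
  - by rewrite act_restr image_setU !image_set1.
  - by rewrite !act_configE Einv.
move=> g gGr p _; congr xget; apply/seteqP; split=> t /=.
  by move=> /(sub g _ _ gGr); rewrite -{1}[g]invgK act_patternK.
by apply: sub; exact: group_closedV.
Qed.

Lemma potential_eq0 x A : X x ->
    (forall v w x', x' v = x v -> x' w = x w -> E v w (x' v) (x' w) = 0) ->
  potential (restr x A) = 0.
Proof.
move=> Xx E0; rewrite /potential; case: xgetP => // _ ->.
move=> [v [w [x' [vw Xx' /restr_inj[AE xx'] ->]]]].
by apply: E0; rewrite xx'// AE inE; [left|right].
Qed.

End Potential.

(** * Changing one site in a bipartite graph *)

Section SingleSite.
Context {R : realType} {V : countType} {G : graph V} {S : choiceType}.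
Variables (X : set (V -> S)).
Hypothesis bip : bipartite G.

Local Open Scope ring_scope.

Lemma cliques_meeting1 v :
  set_bij [set w | nbr G v w] (cliques_meeting G [set v]) (fun w => [set v; w]).
Proof.
split=> [w vw|w w' _ _ ww'|A [Acl [u [/[swap] /= -> Av]]]].
- split; first exact: nbr_clique.
  by exists v; split=> //; left.
- have [/= w'v|//] : [set v; w] w' by rewrite [[set v; w]]ww'; right.
    have [/= wv|//] : [set v; w'] w by rewrite -[[set v; w']]ww'; right.
    by rewrite w'v wv.
- have [A0|[u' [w [uw AE]]]] := bipartite_clique bip Acl.
    by rewrite A0 in Av.
  move: Av; rewrite AE => -[->|->]; first by exists w.
  by exists u'; rewrite 1?setUC //= nbr_sym.
Qed.

(** The cliques through [v] are the sets [[set v; w]] for [w] equal or adjacent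
    to [v], where [w = v] yields the singleton. *)
Lemma gibbs_site (U : @pattern V S -> R) v x y : nn_interaction G X U ->
  X x -> X y -> differ x y `<=` [set v] ->
  gibbs_cocycle U x y =
  \sum_(w \in [set w | nbr G v w])
     (U (restr y [set v; w]) - U (restr x [set v; w])).
Proof.
move=> nnU Xx Xy xy; rewrite (gibbs_cliques_meeting nnU Xx Xy xy).
exact: reindex_fsbig (cliques_meeting1 v).
Qed.

(** For [v = w] only [c = d] is possible, and [ok v v c c] says that the letter
    [c] occurs at [v]. *)
Definition ok v w c d := exists x, [/\ X x, x v = c & x w = d].

Lemma okE x v w : X x -> ok v w (x v) (x w).
Proof. by exists x. Qed.

Lemma ok_sym v w c d : ok v w c d -> ok w v d c.
Proof. by move=> [x [Xx xv xw]]; exists x. Qed.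

(** Membership in a nearest neighbour space is checked on vertices and edges,
    because forbidden patterns live on cliques. Nonemptiness rules out that the
    empty pattern is forbidden. *)
Lemma nn_constraint_glue L x : nn_constraint_space G L X -> X !=set0 ->
  (forall v w, nbr G v w -> ok v w (x v) (x w)) -> X x.
Proof.
move=> [_ [Forb [Fcl XE]]] X_nonempty xok.
rewrite XE; split=> [v|p Fp xp].
  have [z [Xz <- _]] := xok v v (nbr_refl G v).
  by move: Xz; rewrite XE => -[].
have [z Xz zx] : exists2 z, X z & {in Defs.shape p, z =1 x}.
  have [->|[v [w [vw ->]]]] := bipartite_clique bip (Fcl p Fp).
    by have [z Xz] := X_nonempty; exists z => // v; rewrite inE.
  have [z [Xz zv zw]] := xok v w vw.
  by exists z => // u; rewrite inE => -[->|->].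
move: Xz; rewrite XE => -[_ /(_ p Fp)]; apply.
by rewrite -[RHS]xp; exact: eq_restr.
Qed.

End SingleSite.

(** * Folding *)

Section Fold.
Context {V : countType} {G : graph V} {S : choiceType}.
Variables (Gr : {pred aut G}) (L : set S) (X : set (V -> S)) (a b : S).
Hypotheses (bip : bipartite G) (GrG : group_closed Gr).
Hypotheses (Xnn : nn_constraint_space G L X) (Xinv : invariant_space Gr X).
Hypotheses (ab : a <> b) (Xfold : strongly_config_folds G X a b L).

Implicit Types (x y z : V -> S) (g : aut G) (u v w : V) (c d : S) (s : seq V).

Local Notation ok := (ok X).
Local Notation Y := (X `&` [set x | forall v, (L `\ a) (x v)]).
Hypothesis Y0 : Y !=set0.

Lemma alphabet x v : X x -> L (x v).
Proof. by move: Xnn => [_ [Forb [_ ->]]] []. Qed.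

Lemma foldP x : Y x <-> X x /\ forall v, x v <> a.
Proof.
split=> [[Xx xL]|[Xx xa]]; split=> // v; first by case: (xL v).
by split; [exact: alphabet|exact: xa].
Qed.

Lemma X_nonempty : X !=set0.
Proof. by have [x [Xx _]] := Y0; exists x. Qed.

Lemma restr_pair x v w : restr x [set v; w] = pair_pattern (x v) (x w) v w.
Proof.
apply/funext => u; rewrite /restr /pair_pattern.
have [->|/eqP uv] := eqVneq u v; first by rewrite asboolT//; left.
have [->|/eqP uw] := eqVneq u w; first by rewrite asboolT//; right.
by rewrite asboolF// => -[].
Qed.

Lemma language_pair v w c d : v <> w ->
  language_on X [set v; w] (pair_pattern c d v w) <-> ok v w c d.
Proof.
move=> /eqP/negbTE vw; split=> [[x Xx]|[x [Xx <- <-]]]; last first.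
  by exists x => //; rewrite restr_pair.
rewrite restr_pair => xE; exists x; split=> //.
  by have := congr1 (@^~ v) xE; rewrite /pair_pattern eqxx => -[].
have := congr1 (@^~ w) xE.
by rewrite /pair_pattern (eq_sym w v) vw eqxx => -[].
Qed.

Lemma ok_diag v w c d : ok v w c d -> ok v v c c.
Proof. by move=> [x [Xx xv _]]; exists x. Qed.

Lemma ok_fold v w u c : adj G v w -> adj G w u -> ok v w a c ->
  [/\ ok v w b c, ok w u c b &
      exists2 z, X z & forall t, dist2 G v t -> z t = b].
Proof.
move=> vw wu okac; have Lc : L c by have [x [Xx _ <-]] := okac; exact: alphabet.
have /(language_pair _ _ (adj_neq vw)) := okac.
move=> /(Xfold vw wu Lc)[/(language_pair _ _ (adj_neq vw)) ? ? [z Xz zb]].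
split=> //; first exact/(language_pair _ _ (adj_neq wu)).
by exists z => // t vt; have [_ ->] := restr_inj zb; rewrite ?inE.
Qed.

Lemma ok_foldl v w c : adj G v w -> ok v w a c -> ok v w b c.
Proof.
move=> vw okac; have wv : adj G w v by rewrite adj_sym.
by have [] := ok_fold vw wv okac.
Qed.

Lemma ok_foldr v w u c : adj G v w -> adj G w u -> ok v w a c -> ok w u c b.
Proof. by move=> vw wu /(ok_fold vw wu)[]. Qed.

Lemma ok_act g v w c d : g \in Gr -> ok (g v) (g w) c d <-> ok v w c d.
Proof.
move=> gGr; split=> [] [x [Xx <- <-]].
  exists (act_config (g^-1)%g x); rewrite /act_config invgK; split=> //.
  by apply: (invariant_act Xinv (group_closedV GrG gGr)).
exists (act_config g x); rewrite !act_configE; split=> //.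
exact: (invariant_act Xinv gGr).
Qed.

Lemma exists_adj_act (g : aut G) v :
  (exists w, adj G (g v) w) <-> (exists w, adj G v w).
Proof.
split=> -[w vw]; last by exists (g w); rewrite aut_adj.
by exists ((g^-1)%g w); rewrite -(aut_adj g) autVK.
Qed.

(** The folding condition only concerns vertices with a neighbour. At an isolated
    vertex [b] need not be admissible; the choice made there depends on [v] only
    through its set of admissible letters, which the group preserves. *)
Definition replacement v : S :=
  if `[< exists w, adj G v w >] then b
  else xget b [set c | c <> a /\ ok v v c c].

Lemma replacement_adj v w : adj G v w -> replacement v = b.
Proof. by move=> vw; rewrite /replacement asboolT//; exists w. Qed.

Lemma replacement_act g v : g \in Gr -> replacement (g v) = replacement v.
Proof.
move=> gGr; rewrite /replacement (asbool_equiv_eq (exists_adj_act g v)).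
congr (if _ then _ else xget _ _); apply/seteqP.
by split=> c [ca okc]; split=> //; apply/(ok_act v v c c gGr).
Qed.

Lemma replacement_isolated v : (forall w, ~~ adj G v w) ->
  replacement v <> a /\ ok v v (replacement v) (replacement v).
Proof.
move=> nv; rewrite /replacement asboolF; last by move=> [w]; exact/negP.
apply: (@xgetPex _ b [set c | c <> a /\ ok v v c c]).
have [x /foldP[Xx xa]] := Y0.
by exists (x v); split=> //; exact: okE.
Qed.

Lemma replacement_neq v : replacement v <> a.
Proof.
have [[w vw]|nv] := pselect (exists w, adj G v w).
  by rewrite (replacement_adj vw); exact/nesym.
apply: (replacement_isolated _).1 => w.
by apply/negP => vw; apply: nv; exists w.
Qed.

Lemma replacement_ok v : ok v v a a -> ok v v (replacement v) (replacement v).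
Proof.
move=> [x [Xx xv _]]; have [[w vw]|nv] := pselect (exists w, adj G v w).
  rewrite (replacement_adj vw); apply: (@ok_diag _ w _ (x w)).
  by apply: ok_foldl => //; rewrite -xv; exact: okE.
apply: (replacement_isolated _).2 => w.
by apply/negP => vw; apply: nv; exists w.
Qed.

Definition fold_on (K : pred V) (x : V -> S) : V -> S :=
  fun u => if K u && (x u == a) then replacement u else x u.

(** An edge carrying [a] at both ends is handled by folding one end after the
    other. *)
Lemma fold_on_space K x : X x -> X (fold_on K x).
Proof.
move=> Xx; apply: nn_constraint_glue Xnn X_nonempty _ => // v w.
case/orP=> [/eqP <-|vw].
  rewrite /fold_on; case: ifP => [/andP[_ /eqP xv]|_]; last exact: okE.
  by apply: replacement_ok; rewrite -xv; exact: okE.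
have wv : adj G w v by rewrite adj_sym.
have okx := okE v w Xx.
rewrite /fold_on (replacement_adj vw) (replacement_adj wv).
case: ifP => [/andP[_ /eqP xv]|_]; case: ifP => [/andP[_ /eqP xw]|_] //.
- apply/ok_sym/ok_foldl => //; apply/ok_sym/ok_foldl => //.
  by rewrite -{1}xv -xw.
- by apply: ok_foldl; rewrite -?xv.
- by apply/ok_sym/ok_foldl; rewrite -?xw//; exact/ok_sym.
Qed.

Lemma fold_on_id K x : (forall v, x v <> a) -> fold_on K x = x.
Proof.
by move=> xa; apply/funext => v; rewrite /fold_on (introF eqP (xa v)) andbF.
Qed.

Lemma fold_on_in_fold x : X x -> Y (fold_on xpredT x).
Proof.
move=> Xx; apply/foldP; split=> [|v]; first exact: fold_on_space.
by rewrite /fold_on /=; case: eqP => // _; exact: replacement_neq.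
Qed.

Lemma fold_on_act g x : g \in Gr ->
  fold_on xpredT (act_config g x) = act_config g (fold_on xpredT x).
Proof.
move=> gGr; apply/funext => u; rewrite -(autVK g u) act_configE /fold_on.
by rewrite act_configE replacement_act.
Qed.

Lemma differ_fold_on K x y : differ (fold_on K x) (fold_on K y) `<=` differ x y.
Proof. by move=> v; apply: contra_not => xy; rewrite /fold_on xy. Qed.

Lemma asymptotic_fold_on K x y :
  asymptotic X x y -> asymptotic X (fold_on K x) (fold_on K y).
Proof.
move=> [Xx Xy xy]; split; try exact: fold_on_space.
exact: sub_finite_set (@differ_fold_on _ _ _) xy.
Qed.

Lemma asymptotic_fold x y :
  asymptotic X x y -> asymptotic Y (fold_on xpredT x) (fold_on xpredT y).
Proof.
move=> xy; have [_ _ fxy] := asymptotic_fold_on xpredT xy.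
by case: xy => Xx Xy _; split=> //; exact: fold_on_in_fold.
Qed.

Lemma asymptotic_fold_seq s x : X x -> asymptotic X x (fold_on (mem s) x).
Proof.
move=> Xx; split=> //; first exact: fold_on_space.
apply: sub_finite_set (finite_seq s) => v; rewrite /differ /fold_on /=.
by case: (v \in s).
Qed.

Definition erase v x := fold_on (pred1 v) x.

Lemma eraseE v x u :
  erase v x u = if (u == v) && (x u == a) then replacement u else x u.
Proof. by []. Qed.

Lemma erase_neq v x u : u <> v -> erase v x u = x u.
Proof. by move=> /eqP/negbTE uv; rewrite eraseE uv. Qed.

Lemma erase_act g v x : g \in Gr ->
  erase (g v) (act_config g x) = act_config g (erase v x).
Proof.
move=> gGr; apply/funext => u; rewrite -(autVK g u) act_configE !eraseE.
by rewrite act_configE (can_eq (autK g)) replacement_act.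
Qed.

Lemma differ_erase v x : differ x (erase v x) `<=` [set v].
Proof. by move=> u; apply: contra_notP => /erase_neq ->. Qed.

Lemma asymptotic_erase v x : X x -> asymptotic X x (erase v x).
Proof.
move=> Xx; split=> //; first exact: fold_on_space.
exact: sub_finite_set (@differ_erase v x) (finite_set1 v).
Qed.

(** Holds because [replacement] never produces a new [a]. *)
Lemma erase_comm v w x : v <> w -> erase v (erase w x) = erase w (erase v x).
Proof.
move=> vw; apply/funext => u; rewrite eraseE [RHS]eraseE.
have [->|/eqP uv] := eqVneq u v.
  by rewrite (introF eqP vw) /= erase_neq// eraseE eqxx.
by rewrite (erase_neq _ uv) !eraseE/=; case: eqP.
Qed.

Lemma fold_on_cons v s x :
  fold_on (mem (v :: s)) x = erase v (fold_on (mem s) x).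
Proof.
apply/funext => u; rewrite eraseE /fold_on /= in_cons.
case: (u \in s) => /=; rewrite ?orbT ?orbF//.
by case: (x u =P a) => [_|/eqP/negbTE->]; rewrite ?andbF//= if_same.
Qed.

(** * Configurations surrounded by the folding letter *)

Definition upd (x : V -> S) w d : V -> S := fun u => if u == w then d else x u.

Lemma upd_neq x w d u : u <> w -> upd x w d u = x u.
Proof. by move=> /eqP/negbTE uw; rewrite /upd uw. Qed.

Lemma differ_upd x w d : differ x (upd x w d) `<=` [set w].
Proof. by move=> u; apply: contra_notP => uw; rewrite upd_neq. Qed.

Lemma erase_upd v w x d : v <> w -> erase v (upd x w d) = upd (erase v x) w d.
Proof.
move=> vw; apply/funext => u; rewrite eraseE /upd.
by have [->|uw] := eqVneq u w; rewrite ?(introF eqP (nesym vw)).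
Qed.

(** In such a configuration the letters next to [v] can be changed one by one:
    every neighbour of a neighbour [w] of [v] carries [a] (at [v] itself) or
    [b]. *)
Definition surrounded v y :=
  [/\ X y, y v = a & forall u, dist2 G v u -> y u = b].

Lemma adj_dist2 v w u : adj G v w -> adj G w u -> u <> v -> dist2 G v u.
Proof.
move=> vw wu uv; apply/dist2P; split; last by exists w.
by rewrite /nbr (adj_triangle_free bip vw wu) orbF eq_sym; apply/eqP.
Qed.

Lemma surrounded_agree v w y y' : surrounded v y -> surrounded v y' ->
  adj G v w -> y w = y' w -> forall u, nbr G w u -> y u = y' u.
Proof.
move=> [_ yv yb] [_ yv' yb'] vw yw u /orP[/eqP<-//|wu].
have [->|/eqP uv] := eqVneq u v; first by rewrite yv.
by have vu := adj_dist2 vw wu uv; rewrite yb// yb'.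
Qed.

Lemma surrounded_upd v w y d : surrounded v y -> adj G v w -> ok v w a d ->
  surrounded v (upd y w d).
Proof.
move=> [Xy yv yb] vw okd; split; last 2 first.
- by rewrite upd_neq//; exact: adj_neq vw.
- move=> u /[dup] vu /dist2P[nvu _]; rewrite upd_neq ?yb// => uw.
  by move: nvu; rewrite uw adj_nbr.
have okw q : adj G w q -> ok w q d (y q).
  move=> wq; have [->|/eqP qv] := eqVneq q v; first by rewrite yv; exact/ok_sym.
  by rewrite yb; [exact: ok_foldr vw wq okd|exact: adj_dist2 wq qv].
apply: nn_constraint_glue Xnn X_nonempty _ => // p q /orP[/eqP <-|pq].
  rewrite /upd; case: eqP => [->|_]; last exact: okE.
  exact/ok_diag/ok_sym/okd.
rewrite /upd; case: eqP => [pw|_]; case: eqP => [qw|_].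
- by move: pq; rewrite pw qw adj_irrefl.
- by rewrite pw; apply: okw; rewrite -pw.
- by rewrite qw; apply/ok_sym/okw; rewrite -qw adj_sym.
- exact: okE.
Qed.

(** Chosen from a set that the group transports, so that the reference
    configurations below yield invariant quantities. *)
Definition ref_letter v w : S := xget a [set c | ok v w a c].

Lemma ref_letterP v w : ok v v a a -> ok v w a (ref_letter v w).
Proof.
move=> [x [Xx xv _]]; apply: (@xgetPex _ a [set c | ok v w a c]).
by exists (x w); exists x.
Qed.

Lemma ref_letter_act g v w :
  g \in Gr -> ref_letter (g v) (g w) = ref_letter v w.
Proof.
move=> gGr; congr xget; apply/seteqP.
by split=> c okc; apply/(ok_act v w a c gGr).
Qed.

Definition reference v : V -> S := xget (fun=> a)
  [set y | surrounded v y /\ forall w, adj G v w -> y w = ref_letter v w].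

(** Outside the ball of radius two the reference configuration continues some
    configuration of [X] with [b] at distance two, provided by the last clause of
    strong folding; between distance one and two the edges are allowed because
    [b] can stand next to any letter that can stand next to [a]. *)
Lemma referenceP v : ok v v a a -> surrounded v (reference v) /\
  forall w, adj G v w -> reference v w = ref_letter v w.
Proof.
move=> oka; pose P := [set y | surrounded v y /\
  forall w, adj G v w -> y w = ref_letter v w].
suff: exists y, P y by move=> /(xgetPex (fun=> a)).
have [z Xz zb] : exists2 z, X z & forall u, dist2 G v u -> z u = b.
  have [[w vw]|nv] := pselect (exists w, adj G v w).
    have wv : adj G w v by rewrite adj_sym.
    by have [] := ok_fold vw wv (ref_letterP w oka).
  have [x Xx] := X_nonempty; exists x => // u /dist2P[_ [w vw _]].
  by case: nv; exists w.
pose y u := if u == v then a else if adj G v u then ref_letter v u else z u.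
have yv : y v = a by rewrite /y eqxx.
have yN w : adj G v w -> y w = ref_letter v w.
  by move=> vw; rewrite /y vw ifN// eq_sym; apply/eqP/adj_neq/vw.
have yz u : ~~ nbr G v u -> y u = z u.
  by rewrite /nbr /y (eq_sym v) => /norP[/negbTE-> /negbTE->].
have yb u : dist2 G v u -> y u = b.
  by move=> /[dup] vu /dist2P[nvu _]; rewrite yz ?zb.
have half p q : adj G p q -> nbr G v p -> ok p q (y p) (y q).
  move=> pq /orP[/eqP vp|vp].
    by rewrite -vp yv yN -?vp; [exact: ref_letterP|rewrite vp].
  rewrite (yN p vp); have [->|/eqP qv] := eqVneq q v.
    by rewrite yv; apply/ok_sym/ref_letterP.
  rewrite yb; last exact: adj_dist2 pq qv.
  exact: ok_foldr pq (ref_letterP p oka).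
exists y; split=> //; split=> //.
apply: nn_constraint_glue Xnn X_nonempty _ => // p q /orP[/eqP <-|pq].
  have [->|pv] := eqVneq p v; first by rewrite yv.
  have [vp|nvp] := boolP (adj G v p).
    by rewrite yN//; exact/ok_diag/ok_sym/ref_letterP.
  by rewrite yz; [exact: okE|rewrite /nbr negb_or eq_sym pv].
have [vp|nvp] := boolP (nbr G v p); first exact: half.
have [vq|nvq] := boolP (nbr G v q).
  by apply/ok_sym/half => //; rewrite adj_sym.
by rewrite !yz//; exact: okE.
Qed.

(** * The cost of removing one letter *)

Section Cocycle.
Context {R : realType}.
Local Open Scope ring_scope.
Variable M : (V -> S) -> (V -> S) -> R.
Hypothesis MM : markov_cocycles Gr X M.

Let Mmarkov : markov_cocycle G X M := MM.1.
Let Mcocycle : cocycle X M := MM.1.1.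

Lemma markov_site v x y x' y' : X x -> X y -> X x' -> X y' ->
    differ x y `<=` [set v] -> differ x' y' `<=` [set v] ->
    (forall u, nbr G v u -> x u = x' u) ->
    (forall u, nbr G v u -> y u = y' u) -> M x y = M x' y'.
Proof.
move=> Xx Xy Xx' Xy' xy xy' xx yy.
apply: (markov_local (F := [set v]) Mmarkov) => //.
- by split=> //; exact: sub_finite_set xy (finite_set1 v).
- by split=> //; exact: sub_finite_set xy' (finite_set1 v).
- by move=> u; rewrite inE => /closed_nbhdP[_ -> vu]; exact: xx.
- by move=> u; rewrite inE => /closed_nbhdP[_ -> vu]; exact: yy.
Qed.

Definition cost v x : R := M x (erase v x).

Lemma cost_local v x x' : X x -> X x' ->
  (forall u, nbr G v u -> x u = x' u) -> cost v x = cost v x'.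
Proof.
move=> Xx Xx' xx; apply: (@markov_site v) => //; try exact: fold_on_space.
- exact: differ_erase.
- exact: differ_erase.
- by move=> u vu; rewrite !eraseE xx.
Qed.

Lemma cost_act g v x : g \in Gr -> X x ->
  cost (g v) (act_config g x) = cost v x.
Proof.
move=> gGr Xx; rewrite /cost erase_act//.
by apply: (MM.2 g gGr); exact: asymptotic_erase.
Qed.

(** Replacing [a] at [v] and changing the letter at [w] form a commuting square,
    so the difference on each side equals the difference of two costs of changing
    [w]. By the Markov property those depend only on the letters at [w] and its
    neighbours, on which [y] and [y'] agree. *)
Lemma cost_exchange v w y y' d : surrounded v y -> surrounded v y' ->
    adj G v w -> y w = y' w -> ok v w a d ->
  cost v y - cost v (upd y w d) = cost v y' - cost v (upd y' w d).
Proof.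
move=> vy vy' vw yw okd; have nvw := adj_neq vw.
have square z : surrounded v z -> cost v z - cost v (upd z w d) =
    M z (upd z w d) - M (erase v z) (erase v (upd z w d)).
  move=> vz; have [Xz _ _] := vz; have [Xu _ _] := surrounded_upd vz vw okd.
  have zu : asymptotic X z (upd z w d).
    by split=> //; exact: sub_finite_set (@differ_upd z w d) (finite_set1 w).
  have zz := asymptotic_erase v Xz; have uu := asymptotic_erase v Xu.
  have ee := asymptotic_fold_on (pred1 v) zu.
  apply/eqP; rewrite subr_eq addrAC -subr_eq opprK; apply/eqP.
  by rewrite -(Mcocycle zz ee) -(Mcocycle zu uu).
rewrite !square//; have := surrounded_agree vy vy' vw yw => yy.
have [Xy _ _] := vy; have [Xy' _ _] := vy'.
have [Xu _ _] := surrounded_upd vy vw okd.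
have [Xu' _ _] := surrounded_upd vy' vw okd.
have uu u : nbr G w u -> upd y w d u = upd y' w d u.
  by move=> wu; rewrite /upd yy.
congr (_ - _).
  by apply: (@markov_site w) => //; exact: differ_upd.
apply: (@markov_site w); try exact: fold_on_space.
- by rewrite erase_upd//; exact: differ_upd.
- by rewrite erase_upd//; exact: differ_upd.
- by move=> u wu; rewrite !eraseE yy.
- by move=> u wu; rewrite !eraseE uu.
Qed.

(** The contribution of the letter [c] at [w], normalised by the letter of the
    reference configuration. *)
Definition pair_cost v w c : R :=
  cost v (upd (reference v) w c) - cost v (reference v).

(** Starting from the reference configuration, the letters of [x] are copied to
    the neighbours of [v] one at a time; by [cost_exchange] each copy adds the
    same amount as if it were made in the reference configuration itself. *)
Lemma cost_sum v x : X x -> x v = a -> cost v x =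
  cost v (reference v) + \sum_(w \in [set w | adj G v w]) pair_cost v w (x w).
Proof.
move=> Xx xv; have oka : ok v v a a by rewrite -xv; exact: okE.
have [vr rN] := referenceP oka.
pose y s u := if u \in s then x u else reference v u.
have partial s : uniq s -> {subset s <= adj G v} -> surrounded v (y s) /\
    cost v (y s) = cost v (reference v) + \sum_(w <- s) pair_cost v w (x w).
  elim: s => [_ _|w s IHs /= /andP[ws us] sv].
    by rewrite big_nil addr0.
  have [] := IHs us; first by move=> u us'; apply: sv; rewrite in_cons us' orbT.
  have vw : adj G v w by apply: sv; rewrite in_cons eqxx.
  have okw : ok v w a (x w) by rewrite -xv; exact: okE.
  have -> : y (w :: s) = upd (y s) w (x w).
    by apply/funext => u; rewrite /y /upd in_cons; case: eqP => // ->.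
  move=> vy yE; split; first exact: surrounded_upd.
  have ywr : y s w = reference v w by rewrite /y (negbTE ws).
  have := cost_exchange vy vr vw ywr okw.
  by rewrite big_cons addrCA -yE /pair_cost; lra.
have /finite_seqP[s0 s0E] := adj_locally_finite G v.
pose s := undup s0; have sE w : adj G v w = (w \in s).
  by rewrite mem_undup; apply/idP/idP; have /seteqP[s0l s0r] := s0E;
    [exact: s0l|exact: s0r].
have [|w|[Xy yv _] yE] := partial s; [exact: undup_uniq|by rewrite -sE|].
have -> : [set w | adj G v w] = [set` s].
  by apply/seteqP; split=> w /=; rewrite sE.
rewrite -fsbig_seq ?undup_uniq// -yE.
apply: cost_local => // u /orP[/eqP <-|vu]; first by rewrite xv yv.
by rewrite /y -sE vu.
Qed.

Lemma cost_erase_nbr v w x : X x -> adj G v w -> x v = a -> x w = a ->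
  cost v x - cost v (erase w x) = pair_cost v w a - pair_cost v w b.
Proof.
move=> Xx vw xv xw; have wv : adj G w v by rewrite adj_sym.
have ev : erase w x v = a by rewrite erase_neq//; exact: adj_neq vw.
have Xe : X (erase w x) := fold_on_space _ Xx.
rewrite (cost_sum Xx xv) (cost_sum Xe ev).
rewrite opprD addrACA subrr add0r.
have fin := adj_locally_finite G v.
have ewb : erase w x w = b by rewrite eraseE eqxx xw eqxx (replacement_adj wv).
rewrite (fsbigD1 w)// [X in _ - X](fsbigD1 w)//.
rewrite ewb xw /= opprD addrACA.
rewrite -[RHS]addr0; congr (_ + _); apply/eqP; rewrite subr_eq0; apply/eqP.
by apply: eq_fsbigr => u; rewrite inE => -[_ uw]; rewrite erase_neq.
Qed.

(** The two orders of removing both [a] have the same total cost, and all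
    contributions other than those of the edge between [v] and [w] cancel. *)
Lemma pair_cost_sym x v w : X x -> adj G v w -> x v = a -> x w = a ->
  pair_cost v w a + pair_cost w v b = pair_cost w v a + pair_cost v w b.
Proof.
move=> Xx vw xv xw; have wv : adj G w v by rewrite adj_sym.
have Xv : X (erase v x) := fold_on_space _ Xx.
have Xw : X (erase w x) := fold_on_space _ Xx.
have vwE : M x (erase w (erase v x)) = cost v x + cost w (erase v x) :=
  Mcocycle (asymptotic_erase v Xx) (asymptotic_erase w Xv).
have wvE : M x (erase v (erase w x)) = cost w x + cost v (erase w x) :=
  Mcocycle (asymptotic_erase w Xx) (asymptotic_erase v Xw).
rewrite (erase_comm _ (adj_neq vw)) vwE in wvE.
have := cost_erase_nbr Xx vw xv xw; have := cost_erase_nbr Xx wv xw xv.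
by lra.
Qed.

(** The group need not transport reference configurations to each other, but
    the letters prescribed on the closed neighbourhood of [v] agree, and
    the cost sees nothing else. *)
Lemma cost_reference_act g v : g \in Gr -> ok v v a a ->
  cost (g v) (reference (g v)) = cost v (reference v).
Proof.
move=> gGr oka; have [[Xr rv _] rN] := referenceP oka.
have [[Xgr grv _] grN] := referenceP ((ok_act v v a a gGr).2 oka).
rewrite -(cost_act v gGr Xr); apply: cost_local => //.
  exact: (invariant_act Xinv gGr).
move=> u; rewrite -(autVK g u) nbr_aut act_configE => /orP[/eqP<-|vu].
  by rewrite rv.
by rewrite rN// grN ?aut_adj// ref_letter_act.
Qed.

Lemma pair_cost_act g v w c : g \in Gr -> adj G v w -> ok v w a c ->
  pair_cost (g v) (g w) c = pair_cost v w c.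
Proof.
move=> gGr vw okc; have oka := ok_diag okc.
have okga := (ok_act v v a a gGr).2 oka.
have [vr rN] := referenceP oka; have [gvr grN] := referenceP okga.
rewrite /pair_cost cost_reference_act//; congr (_ - _).
have [Xu uv _] := surrounded_upd vr vw okc.
have gvw : adj G (g v) (g w) by rewrite aut_adj.
have [Xgu guv _] := surrounded_upd gvr gvw ((ok_act v w a c gGr).2 okc).
rewrite -(cost_act v gGr Xu); apply: cost_local => //.
  exact: (invariant_act Xinv gGr).
move=> u; rewrite -(autVK g u) nbr_aut act_configE => /orP[/eqP<-|vu].
  by rewrite guv uv.
rewrite /upd (can_eq (autK g)); case: eqP => // _.
by rewrite rN// grN ?aut_adj// ref_letter_act.
Qed.

(** Minus the cost of removing every [a] from the vertex or edge. On an edge with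
    two [a], first the one at [v] is removed next to an [a], then the one at [w]
    next to a [b]. *)
Definition fold_energy v w c d : R :=
  if v == w then (if c == a then - cost v (reference v) else 0)
  else if c == a then
    (if d == a then - (pair_cost v w a + pair_cost w v b)
     else - pair_cost v w d)
  else if d == a then - pair_cost w v c else 0.

Lemma fold_energy0 v w c d : c <> a -> d <> a -> fold_energy v w c d = 0.
Proof.
by move=> /eqP/negbTE ca /eqP/negbTE da; rewrite /fold_energy ca da if_same.
Qed.

Lemma fold_energy_sym v w x : nbr G v w -> X x ->
  fold_energy v w (x v) (x w) = fold_energy w v (x w) (x v).
Proof.
move=> /orP[/eqP->//|vw] Xx; rewrite /fold_energy eq_sym.
have -> /= : (w == v) = false by apply/eqP/nesym/adj_neq/vw.
case: eqP => xv; case: eqP => xw //.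
by have := pair_cost_sym Xx vw xv xw; lra.
Qed.

Lemma fold_energy_act g v w x : g \in Gr -> nbr G v w -> X x ->
  fold_energy (g v) (g w) (x v) (x w) = fold_energy v w (x v) (x w).
Proof.
move=> gGr vw Xx; rewrite /fold_energy (can_eq (autK g)).
have okx := okE v w Xx; case: eqP => [|/eqP nvw].
  case: eqP => // xv vw'; rewrite cost_reference_act//.
  by move: okx; rewrite -vw' xv.
case/orP: vw nvw => [->//|vw _]; have wv : adj G w v by rewrite adj_sym.
case: eqP => xv; case: eqP => xw //.
- rewrite xv xw in okx; rewrite (pair_cost_act gGr vw okx).
  by rewrite (pair_cost_act gGr wv (ok_sym (ok_foldl vw okx))).
- by rewrite xv in okx; rewrite pair_cost_act.
- by rewrite xw in okx; rewrite (pair_cost_act gGr wv (ok_sym okx)).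
Qed.

Definition fold_interaction : @pattern V S -> R :=
  @potential R V G S X fold_energy.

Lemma fold_interaction_nn : nn_interaction G X fold_interaction.
Proof. exact: potential_nn. Qed.

Lemma fold_interaction_invariant : invariant_interaction Gr X fold_interaction.
Proof. by apply: potential_invariant => //; exact: fold_energy_act. Qed.

Lemma fold_interaction_eq0 x A : Y x -> fold_interaction (restr x A) = 0.
Proof.
move=> /foldP[Xx xa]; apply: potential_eq0 => // v w x' xv xw.
by rewrite fold_energy0// ?xv ?xw.
Qed.

(** The vertex term contributes the constant of [cost_sum] and the edge between
    [v] and [w] contributes [pair_cost v w (x w)]. If [x w = a], one term
    [pair_cost w v b] remains after the removal and cancels. *)
Lemma gibbs_fold_interaction v x : X x ->
  gibbs_cocycle fold_interaction x (erase v x) = cost v x.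
Proof.
move=> Xx; have Xe : X (erase v x) by exact: fold_on_space.
have [xv|/negbTE xv] := eqVneq (x v) a; last first.
  have ex : erase v x = x.
    by apply/funext => u; rewrite eraseE; case: eqP => //= ->; rewrite xv.
  rewrite /cost ex (cocycle_refl Mcocycle Xx).
  exact: cocycle_refl (gibbs_cocycleP fold_interaction_nn) Xx.
rewrite (gibbs_site bip fold_interaction_nn Xx Xe (@differ_erase v x)).
rewrite (fsbigD1 v)//=; [|exact: finite_nbr|exact: nbr_refl].
have restrE w z : nbr G v w -> X z ->
    fold_interaction (restr z [set v; w]) = fold_energy v w (z v) (z w).
  by move=> vw Xz; apply: potential_restr => //; exact: fold_energy_sym.
have -> : [set w | nbr G v w] `\ v = [set w | adj G v w].
  apply/seteqP; split=> [w [/orP[/eqP ->|//] []]//|w vw].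
  by split; [exact: adj_nbr|exact/nesym/adj_neq/vw].
rewrite (cost_sum Xx xv) !restrE ?nbr_refl//; congr (_ + _).
  rewrite eraseE eqxx xv eqxx /= fold_energy0; try exact: replacement_neq.
  by rewrite /fold_energy !eqxx sub0r opprK.
apply: eq_fsbigr => w; rewrite inE => vw; rewrite !restrE ?adj_nbr//.
have ev : erase v x v = b by rewrite eraseE eqxx xv eqxx (replacement_adj vw).
have ba : b <> a by exact/nesym.
have -> : erase v x w = x w by rewrite erase_neq//; exact/nesym/adj_neq/vw.
rewrite ev xv /fold_energy (introF eqP (adj_neq vw)) (introF eqP ba) eqxx.
by case: eqP => [->|_]; lra.
Qed.

(** The difference [D] between [M] and the Gibbs cocycle is Markov and does not
    change when an [a] is removed. Removing all [a] from the closed neighbourhood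
    of the set of difference, and then folding everything, turns any asymptotic
    pair into one in the fold. *)
Lemma fold_gibbs : (forall x y, asymptotic Y x y -> M x y = 0) ->
  gibbs_cocycles Gr X M.
Proof.
move=> M0; exists fold_interaction; split; first exact: fold_interaction_nn.
  exact: fold_interaction_invariant.
move=> x y xy; apply/eqP; rewrite -subr_eq0; apply/eqP.
pose D x y := M x y - gibbs_cocycle fold_interaction x y.
rewrite -/(D x y).
have Dmarkov : markov_cocycle G X D.
  have /gibbs_sub_markov gibbsM :
      gibbs_cocycles Gr X (gibbs_cocycle fold_interaction).
    exists fold_interaction; split=> //; first exact: fold_interaction_nn.
    exact: fold_interaction_invariant.
  by have [] := markov_cocyclesB MM (gibbsM GrG Xinv).
have Dc := Dmarkov.1.
have Derase v z : X z -> D z (erase v z) = 0.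
  by move=> Xz; rewrite /D gibbs_fold_interaction// subrr.
have Dseq s z : X z -> D z (fold_on (mem s) z) = 0.
  move=> Xz; elim: s => [|v s IHs].
    by rewrite (_ : fold_on _ z = z) ?(cocycle_refl Dc)//; apply/funext.
  rewrite fold_on_cons (Dc _ _ _ (asymptotic_fold_seq s Xz)).
    by rewrite IHs Derase ?addr0//; exact: fold_on_space.
  by apply: asymptotic_erase; exact: fold_on_space.
have [Xx Xy fxy] := xy.
have /finite_seqP[s sE] := finite_closed_nbhd G fxy.
have -> : D x y = D (fold_on (mem s) x) (fold_on (mem s) y).
  have := Dc _ _ _ (asymptotic_fold_seq s Xx) (asymptotic_fold_on (mem s) xy).
  have := Dc _ _ _ xy (asymptotic_fold_seq s Xy).
  by rewrite !Dseq//; lra.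
have agree z : {in closed_nbhd G (differ x y),
    fold_on (mem s) z =1 fold_on xpredT z}.
  by move=> u; rewrite sE inE /= => us; rewrite /fold_on /= us.
have Yxy := asymptotic_fold xy.
rewrite (markov_local (F := differ x y) Dmarkov (asymptotic_fold_on _ xy)
  (asymptotic_fold_on xpredT xy) (@differ_fold_on _ _ _) (@differ_fold_on _ _ _)
  (agree x) (agree y)).
rewrite /D M0// /gibbs_cocycle fsbig1 ?subrr// => A _.
by have [? ? _] := Yxy; rewrite !fold_interaction_eq0// subrr.
Qed.

End Cocycle.
(** * Transfer of the Hammersley-Clifford property *)

Lemma invariant_fold : invariant_space Gr Y.
Proof. by apply: invariant_spaceI => // g x xL v; exact: xL. Qed.

(** Folding is local and cannot enlarge the set of difference, so the Markov
    property is inherited. *)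
Lemma fold_markov_extension (R : realType) (M : (V -> S) -> (V -> S) -> R) :
  markov_cocycles Gr Y M ->
  markov_cocycles Gr X (fun x y => M (fold_on xpredT x) (fold_on xpredT y)).
Proof.
move=> [Mmarkov Minv]; split; [split|].
- by move=> x y z xy yz; apply: Mmarkov.1; exact: asymptotic_fold.
- move=> x y x' y' xy xy' F F' /restr_inj[FF' xx'] /restr_inj[_ yy'].
  have dd : F = F'.
    apply: differ_agree xx' yy'; first exact: subsetUl.
    by rewrite FF'; exact: subsetUl.
  apply: (markov_local (F := F) Mmarkov); try exact: asymptotic_fold.
  + exact: differ_fold_on.
  + by rewrite dd; exact: differ_fold_on.
  + by move=> v vF; rewrite /fold_on xx'.
  + by move=> v vF; rewrite /fold_on yy'.
- move=> g gGr x y xy; rewrite !fold_on_act//.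
  by apply: Minv => //; exact: asymptotic_fold.
Qed.

Lemma fold_hammersley_clifford (R : realType) :
  hammersley_clifford R Gr X -> hammersley_clifford R Gr Y.
Proof.
move=> [_ HC]; apply: hammersley_cliffordP => //; first exact: invariant_fold.
move=> M /fold_markov_extension; rewrite HC => -[U [nnU Uinv MU]].
have YX : Y `<=` X by move=> x [].
exists U; split=> [p Yp|g gGr p Yp|x y [Yx Yy xy]].
- by apply: nnU; exact: sub_language YX _ Yp.
- by apply: Uinv => //; exact: sub_language YX _ Yp.
- rewrite -MU; last by split=> //; exact: YX.
  have [[_ xa] [_ ya]] := ((foldP x).1 Yx, (foldP y).1 Yy).
  by rewrite !fold_on_id.
Qed.

Lemma unfold_hammersley_clifford (R : realType) :
  hammersley_clifford R Gr Y -> hammersley_clifford R Gr X.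
Proof.
move=> [_ HC]; apply: hammersley_cliffordP => // M MM.
have YX : Y `<=` X by move=> x [].
have asYX x y : asymptotic Y x y -> asymptotic X x y.
  by move=> [Yx Yy xy]; split=> //; exact: YX.
have : markov_cocycles Gr Y M.
  split; [split|].
  - by move=> x y z /asYX xy /asYX yz; apply: MM.1.1.
  - by move=> x y x' y' /asYX xy /asYX xy'; apply: MM.1.2.
  - by move=> g gGr x y /asYX xy; apply: MM.2.
rewrite HC => -[U [nnU Uinv MU]].
(* The interaction on the fold, extended by zero to the other patterns. *)
pose U' p := if `[< language Y p >] then U p else 0%R.
have nnU' : nn_interaction G X U'.
  by move=> p _ pcl; rewrite /U'; case: asboolP => // Yp; exact: nnU.
have Uinv' : invariant_interaction Gr X U'.
  move=> g gGr p _; have gGr' := group_closedV GrG gGr.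
  rewrite /U'; case: asboolP => Yp.
    have Yp' : language Y p.
      rewrite -(act_patternK (g^-1)%g p) invgK.
      exact: (language_act invariant_fold gGr Yp).
    by rewrite asboolT// Uinv.
  rewrite asboolF// => Yp'; apply: Yp.
  exact: (language_act invariant_fold gGr' Yp').
have gibbsU' : gibbs_cocycles Gr X (@gibbs_cocycle R V S U') by exists U'.
have MU' x y : asymptotic Y x y -> M x y = gibbs_cocycle U' x y.
  move=> xy; rewrite MU//; have [Yx Yy _] := xy.
  apply: eq_fsbigr => A; rewrite inE => Afin.
  by rewrite /U' !asboolT//; exact: language_restr.
have [] := @fold_gibbs R (fun x y => M x y - gibbs_cocycle U' x y)%R.
- by apply: markov_cocyclesB MM _; exact: gibbs_sub_markov.
- by move=> x y /MU' ->; rewrite subrr.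
move=> W [nnW Winv MW]; exists (fun p => U' p + W p)%R.
split=> [p Xp pcl|g gGr p Xp|x y xy].
- by rewrite nnU'// nnW// addr0.
- by rewrite Uinv'// Winv.
- by rewrite (gibbs_cocycleD nnU' nnW xy) -MW// addrC subrK.
Qed.

End Fold.

(* The hypothesis [Z !=set0 -> X !=set0] only discards nonempty unfolds of the
   empty space. These exist only when the graph has isolated vertices, which the
   folding condition does not constrain, and they need not be
   Hammersley-Clifford. *)
Theorem theorem4p2 (R : realType) (V : countType) (G : graph V)
    (S : choiceType) (Gr : {pred aut G}) (L : set S) (X : set (V -> S)) :
  bipartite G -> group_closed Gr -> nn_constraint_space G L X ->
  hammersley_clifford R Gr X ->
  (forall Y, strong_config_fold G L X Y -> hammersley_clifford R Gr Y) /\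
  (forall Z, strong_config_unfold G X Z -> invariant_space Gr Z ->
     (Z !=set0 -> X !=set0) -> hammersley_clifford R Gr Z).
Proof.
move=> bip GrG Xnn HC; split=> [Y [a [b [_ _ ab fold YE]]]|].
  have [Y0|Y0] := pselect (Y !=set0).
    rewrite YE in Y0 *.
    exact: (fold_hammersley_clifford bip GrG Xnn HC.1 ab fold).
  apply: hammersley_clifford_empty => //.
  by rewrite YE; exact: (invariant_fold L a GrG HC.1).
move=> Z [L' [Znn [a [b [_ _ ab fold XE]]]]] Zinv ZX.
have [Z0|Z0] := pselect (Z !=set0); last exact: hammersley_clifford_empty.
have X0 := ZX Z0; rewrite XE in X0 HC.
exact: (unfold_hammersley_clifford bip GrG Znn Zinv ab fold X0 HC).
Qed.
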